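(* The following problem (the min-max problem in the stable matchings with flexible quotas setting) is solvable in polynomial time: given an instance as described in the context, compute an $\mathcal{A}$-perfect stable matching $M$ minimizing $\max_{p\in\mathcal{B}} |M(p)|\cdot c(p)$.
   Context: An instance consists of a bipartite graph $G=(\mathcal{A}\cup\mathcal{B},E)$, where $\mathcal{A}$ is a set of agents, $\mathcal{B}$ a set of programs, and $(a,p)\in E$ iff $a$ and $p$ are mutually acceptable. Each agent ranks its neighbours (acceptable programs) in a strict order and each program ranks its neighbours (acceptable agents) in a strict order; $y>_x z$ means $x$ prefers $y$ to $z$. Each program $p$ has a non-negative integer cost $c(p)$; programs have no quotas. A matching $M\subseteq E$ assigns each agent to at most one program (a program may receive any number of agents, possibly zero); $M(a)$ is the program of $a$ and $M(p)$ the set of agents assigned to $p$. An agent prefers any acceptable program to being unmatched. A pair $(a,p)\in E\setminus M$ blocks $M$ if $p>_a M(a)$ and there is $a'\in M(p)$ with $a>_p a'$; $M$ is stable if no pair blocks it. $M$ is $\mathcal{A}$-perfect if every agent is matched. *)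

(* Defs.v *)
From mathcomp Require Import all_boot.

Set Implicit Arguments.
Unset Strict Implicit.
Unset Printing Implicit Defensive.

(** * Random-access machines with logarithmic cost

    Time is measured on a structured random-access machine.  A program uses
    finitely many unbounded arrays of natural numbers; the name of an array is
    part of the program text, an index is computed at run time.  A scalar
    variable is an array used at index 0 only.  Every operation is charged the
    bit lengths of all the numbers it handles, addresses included (the
    logarithmic cost criterion of Aho, Hopcroft and Ullman), so that
    polynomial time on this machine is polynomial time on a Turing machine,
    even though multiplication is available. *)

Inductive expr : Type :=
| Const of nat
| Read of nat & expr
| Add of expr & expr
| Sub of expr & expr
| Mul of expr & expr.

(** Conditions are expressions; a nonzero value means true. *)
Inductive prog : Type :=
| Skip
| Write of nat & expr & expr
| Seq of prog & prog
| If of expr & prog & prog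
| While of expr & prog.

(** [s k i] is the content of cell [i] of array [k]. *)
Definition store := nat -> nat -> nat.

Definition update (s : store) (k i v : nat) : store :=
  fun k' i' => if (k' == k) && (i' == i) then v else s k' i'.

(** Length of the binary representation, with [bits 0 = 1]. *)
Definition bits (n : nat) : nat := (trunc_log 2 n).+1.

(** [Sub] is truncated subtraction. *)
Fixpoint eval (s : store) (e : expr) : nat :=
  match e with
  | Const n => n
  | Read k e1 => s k (eval s e1)
  | Add e1 e2 => eval s e1 + eval s e2
  | Sub e1 e2 => eval s e1 - eval s e2
  | Mul e1 e2 => eval s e1 * eval s e2
  end.

(** The operands of an operation are the values of its subexpressions, whose
    bit lengths are charged when these are evaluated. *)
Fixpoint eval_cost (s : store) (e : expr) : nat :=
  bits (eval s e) +
  match e with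
  | Const _ => 0
  | Read _ e1 => eval_cost s e1
  | Add e1 e2 | Sub e1 e2 | Mul e1 e2 => eval_cost s e1 + eval_cost s e2
  end.

(** [exec c s t s']: started in store [s], the program [c] halts in store [s']
    after time [t]. *)
Inductive exec : prog -> store -> nat -> store -> Prop :=
| exec_skip s : exec Skip s 1 s
| exec_write s k i e :
    exec (Write k i e) s (eval_cost s i + eval_cost s e).+1
         (update s k (eval s i) (eval s e))
| exec_seq c1 c2 s s1 s2 t1 t2 :
    exec c1 s t1 s1 -> exec c2 s1 t2 s2 -> exec (Seq c1 c2) s (t1 + t2).+1 s2
| exec_if_true e c1 c2 s s1 t :
    eval s e != 0 -> exec c1 s t s1 ->
    exec (If e c1 c2) s (eval_cost s e + t).+1 s1
| exec_if_false e c1 c2 s s1 t :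
    eval s e = 0 -> exec c2 s t s1 ->
    exec (If e c1 c2) s (eval_cost s e + t).+1 s1
| exec_while_true e c s s1 s2 t1 t2 :
    eval s e != 0 -> exec c s t1 s1 -> exec (While e c) s1 t2 s2 ->
    exec (While e c) s (eval_cost s e + t1 + t2).+1 s2
| exec_while_false e c s :
    eval s e = 0 -> exec (While e c) s (eval_cost s e).+1 s.

(** The machine is deterministic: a program has at most one halting run from
    a given store. *)
Lemma exec_det c s t1 s1 t2 s2 :
  exec c s t1 s1 -> exec c s t2 s2 -> t1 = t2 /\ s1 = s2.
Proof.
move=> H1; elim: H1 t2 s2 => {c s t1 s1}
  [s|s k i e|c1 c2 s sa sb ta tb _ IH1 _ IH2|e c1 c2 s sa ta e1 _ IH
  |e c1 c2 s sa ta e0 _ IH|e c s sa sb ta tb e1 _ IH1 _ IH2|e c s e0] t' s' H;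
  inversion H; subst; repeat match goal with
  | H1 : is_true (eval ?s ?e != 0), H2 : eval ?s ?e = 0 |- _ =>
      by rewrite H2 in H1
  | IH : (forall t2 s2, exec ?c ?s t2 s2 -> _), H2 : exec ?c ?s _ _ |- _ =>
      case: (IH _ _ H2) => ??; subst; clear IH
  end; by [].
Qed.

(** Array 0 initially holds the input word, array 1 finally holds the output
    word: the length in cell 0, the letters in the cells 1, 2, ... .  All the
    other cells are initially 0. *)
Definition load (w : seq nat) : store :=
  fun k i => if k == 0 then nth 0 (size w :: w) i else 0.

Definition output (s : store) : seq nat :=
  mkseq (fun i => s 1 i.+1) (s 1 0).

Definition word_size (w : seq nat) : nat := \sum_(x <- w) bits x.

(** The search problem "given [x], find [y] with [sol x y]" is solvable in
    polynomial time: one program, on every input [x], halts within a number of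
    steps polynomial in the bit length of (the encoding of) [x], with a solution
    as output. *)
Definition polytime_solvable (I : Type) (O : I -> Type)
    (enc_in : I -> seq nat) (enc_out : forall x, O x -> seq nat)
    (sol : forall x, O x -> Prop) : Prop :=
  exists (c : prog) (b d : nat), forall x : I,
  exists (t : nat) (s : store) (y : O x),
    [/\ exec c (load (enc_in x)) t s,
        t <= b * word_size (enc_in x) ^ d + b,
        output s = enc_out x y
      & sol x y].

(** * Stable matchings with flexible quotas *)

(** The strict order of an agent (a program) on its neighbours is given by its
    preference list: the neighbours without repetition, most preferred first. *)
Record instance : Type := Instance {
  nA : nat;
  nB : nat;
  edge : 'I_nA -> 'I_nB -> bool;
  prefA : 'I_nA -> seq 'I_nB;
  prefB : 'I_nB -> seq 'I_nA;
  cost : 'I_nB -> nat;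
  prefA_uniq : forall a, uniq (prefA a);
  prefB_uniq : forall p, uniq (prefB p);
  mem_prefA : forall a p, (p \in prefA a) = edge a p;
  mem_prefB : forall p a, (a \in prefB p) = edge a p
}.

Definition prefers (T : eqType) (l : seq T) (y z : T) : bool :=
  [&& y \in l, z \in l & index y l < index z l].

Section Matchings.
Variable G : instance.

(** [M a = None] means that [a] is unmatched. *)
Definition assignment := {ffun 'I_(nA G) -> option 'I_(nB G)}.

Implicit Type M : assignment.

Definition assigned M (p : 'I_(nB G)) : {set 'I_(nA G)} :=
  [set a | M a == Some p].

Definition is_matching M : Prop := forall a p, M a = Some p -> edge a p.

Definition agent_prefers (a : 'I_(nA G)) (p : 'I_(nB G))
    (o : option 'I_(nB G)) : bool :=
  if o is Some q then prefers (prefA a) p q else p \in prefA a.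

Definition blocks M (a : 'I_(nA G)) (p : 'I_(nB G)) : bool :=
  [&& edge a p, M a != Some p, agent_prefers a p (M a)
    & [exists a' in assigned M p, prefers (prefB p) a a']].

Definition stable M : Prop := forall a p, ~~ blocks M a p.

Definition A_perfect M : Prop := forall a, M a != None.

Definition max_cost M : nat := \max_(p < nB G) #|assigned M p| * cost p.

Definition feasible M : Prop := [/\ is_matching M, stable M & A_perfect M].

Definition minmax_optimal M : Prop :=
  feasible M /\ forall M', feasible M' -> max_cost M <= max_cost M'.

(** The answer [None] reports that there is no A-perfect stable matching. *)
Definition minmax_solution (r : option assignment) : Prop :=
  if r is Some M then minmax_optimal M else forall M, ~ feasible M.

End Matchings.

(** * Encodings *)

(** Number of agents and of programs, then the agents' preference lists, then
    the programs' costs and preference lists, each list preceded by its length.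
    By [word_size], costs are counted in binary. *)
Definition encode_list (n : nat) (l : seq 'I_n) : seq nat :=
  size l :: [seq val x | x <- l].

Definition encode_instance (G : instance) : seq nat :=
  nA G :: nB G ::
    flatten [seq encode_list (prefA a) | a <- enum 'I_(nA G)] ++
    flatten [seq cost p :: encode_list (prefB p) | p <- enum 'I_(nB G)].

(** Agent by agent, [0] if unmatched and [p.+1] if assigned to [p], after the
    leading letter [1]; the word [0] is the answer [None]. *)
Definition encode_answer (G : instance) (r : option (assignment G)) : seq nat :=
  if r is Some M then
    1 :: [seq (if M a is Some p then p.+1 else 0) | a <- enum 'I_(nA G)]
  else [:: 0].

(* Main.v *)
Require Import Defs.
From mathcomp Require Import all_boot.
From mathcomp Require Import zify.

(** For cutoffs [cut p], let every agent choose its favourite among the programs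
    that rank it among their first [cut p] agents.  The resulting assignment is
    always stable.  Start with cutoffs that admit everybody, and repeatedly
    record the current assignment if it is A-perfect and cheaper than the best
    one so far, of cost [T], and lower by one the cutoff of every program whose
    load times cost is at least [T].  No assignment cheaper than [T] is lost:
    if it gave a program [p] the agent of rank [cut p - 1], stability would
    force all the agents that now choose [p] into [p] as well, so that [p] alone
    would cost [T].  As long as the assignment is A-perfect and [T > 0], each
    round lowers a cutoff; otherwise the best one recorded is optimal.

    The running time is bounded uniformly: all loops of the program run over the
    length of the input, and every stored value exceeds the earlier ones by at
    most a sum of input letters, so that numbers keep polynomial length. *)

Set Implicit Arguments.
Unset Strict Implicit.
Unset Printing Implicit Defensive.

(** * Polynomially bounded functions *)

Definition poly_bounded (f : nat -> nat) : Prop :=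
  exists b d, forall n, f n <= b * n.+1 ^ d.

Lemma poly_const k : poly_bounded (fun=> k).
Proof. by exists k, 0 => n; rewrite muln1. Qed.

Lemma poly_id : poly_bounded id.
Proof. by exists 1, 1 => n; rewrite mul1n expn1. Qed.

Lemma polyD f g :
  poly_bounded f -> poly_bounded g -> poly_bounded (fun n => f n + g n).
Proof.
move=> [b [d fle]] [b' [d' gle]]; exists (b + b'), (d + d') => n.
rewrite mulnDl expnD; apply: leq_add.
  by rewrite (leq_trans (fle n)) // leq_mul // leq_pmulr // expn_gt0.
by rewrite (leq_trans (gle n)) // leq_mul // leq_pmull // expn_gt0.
Qed.

Lemma polyM f g :
  poly_bounded f -> poly_bounded g -> poly_bounded (fun n => f n * g n).
Proof.
move=> [b [d fle]] [b' [d' gle]]; exists (b * b'), (d + d') => n.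
by rewrite expnD mulnACA leq_mul.
Qed.

(** For [n > 0] one has [m.+1 <= 2 * n], which costs the factor [2 ^ d]; at [n = 0] the additive
    constant takes over. Quantifying over [m <= n] spares any monotonicity of [f]. *)
Lemma poly_bounded_expn f : poly_bounded f ->
  exists b d, forall m n, m <= n -> f m <= b * n ^ d + b.
Proof.
move=> [b [d fle]]; exists (b * 2 ^ d), d => m n lemn.
apply: leq_trans (fle m) _; rewrite -mulnA -expnMn.
have [n0 | n0] := posnP n.
  have -> : m = 0 by lia.
  by rewrite exp1n muln1 (leq_trans _ (leq_addl _ _)) // leq_pmulr // expn_gt0.
rewrite (leq_trans _ (leq_addr _ _)) // leq_mul //.
by case: (d) => // d'; rewrite leq_exp2r //; lia.
Qed.

(** * Bit lengths *)

Lemma bits_le m n : m <= n -> bits m <= bits n.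
Proof. by move=> lemn; rewrite /bits ltnS leq_trunc_log. Qed.

Lemma ltn_bits n : n < 2 ^ bits n.
Proof. by rewrite /bits trunc_log_ltn. Qed.

Lemma bits_leP n k : 0 < k -> n < 2 ^ k -> bits n <= k.
Proof.
move=> k0 nk; rewrite /bits; have [->|n0] := posnP n.
  by rewrite trunc_log0.
by rewrite -(ltn_exp2l _ _ (ltnSn 1)) (leq_ltn_trans _ nk) // trunc_logP.
Qed.

Lemma bitsD m n : bits (m + n) <= bits m + bits n.
Proof.
apply: bits_leP => //; rewrite expnD.
have := ltn_bits m; have := ltn_bits n.
move: (2 ^ bits m) (2 ^ bits n) => x y; nia.
Qed.

Lemma bitsM m n : bits (m * n) <= bits m + bits n.
Proof. by apply: bits_leP => //; rewrite expnD ltn_mul // ltn_bits. Qed.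

Lemma bits_leS n : bits n <= n.+1.
Proof. by apply: bits_leP => //; rewrite (ltn_trans _ (ltn_expl _ _)). Qed.

Lemma leq_size_word_size w : size w <= word_size w.
Proof. by rewrite /word_size -sum1_size leq_sum. Qed.

Lemma bits_le_word_size w x : x \in w -> bits x <= word_size w.
Proof.
move=> xw; rewrite /word_size (perm_big _ (perm_to_rem xw)) big_cons.
exact: leq_addr.
Qed.

(** * Programs with loops bounded by the length of the input *)

(** [CFor x c] runs [c] with the variable [x] taking the values
    [0, ..., L - 1], where [L] is the length of the input. *)
Inductive cmd : Type :=
| CWrite of nat & expr & expr
| CSeq of cmd & cmd
| CIf of expr & cmd
| CFor of nat & cmd.

Notation Var x := (Read x (Const 0)).

Fixpoint compile (c : cmd) : prog :=
  match c with
  | CWrite k i e => Write k i e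
  | CSeq c1 c2 => Seq (compile c1) (compile c2)
  | CIf e c1 => If e (compile c1) Skip
  | CFor x c1 =>
      Seq (Write x (Const 0) (Const 0))
        (While (Defs.Sub (Var 0) (Var x))
           (Seq (compile c1) (Write x (Const 0) (Add (Var x) (Const 1)))))
  end.

Fixpoint run (L : nat) (c : cmd) (s : store) : store :=
  match c with
  | CWrite k i e => update s k (eval s i) (eval s e)
  | CSeq c1 c2 => run L c2 (run L c1 s)
  | CIf e c1 => if eval s e != 0 then run L c1 s else s
  | CFor x c1 =>
      iter L (fun s1 => let s2 := run L c1 s1 in update s2 x 0 (s2 x 0 + 1))
        (update s x 0 0)
  end.

Fixpoint written (c : cmd) : seq nat :=
  match c with
  | CWrite k _ _ => [:: k]
  | CSeq c1 c2 => written c1 ++ written c2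
  | CIf _ c1 => written c1
  | CFor x c1 => x :: written c1
  end.

(** Such a value is bounded by input letters and constants alone: only array 0, which is never
    overwritten, is read. A subtrahend is arbitrary because truncated subtraction never increases a
    value. *)
Fixpoint small_expr (e : expr) : bool :=
  match e with
  | Const _ => true
  | Read k _ => k == 0
  | Add e1 e2 => small_expr e1 && small_expr e2
  | Defs.Sub e1 _ => small_expr e1
  | Mul _ _ => false
  end.

(** The value exceeds the maximum of the store by a sum of input letters only. *)
Fixpoint additive_expr (e : expr) : bool :=
  match e with
  | Const _ | Read _ _ => true
  | Add e1 e2 => additive_expr e1 && small_expr e2
  | Defs.Sub e1 _ => additive_expr e1
  | Mul _ _ => false
  end.

(** Never writing array 0 keeps the input intact, and a body that leaves its counter alone makes the
    loop run exactly [L] times. Indices and conditions may contain products, as they are not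
    stored. *)
Fixpoint well_formed (c : cmd) : bool :=
  match c with
  | CWrite k _ e => (k != 0) && additive_expr e
  | CSeq c1 c2 => well_formed c1 && well_formed c2
  | CIf _ c1 => well_formed c1
  | CFor x c1 => [&& x != 0, x \notin written c1 & well_formed c1]
  end.

Lemma run_frame L c s k i : k \notin written c -> run L c s k i = s k i.
Proof.
elim: c s => [k' e1 e2|c1 IH1 c2 IH2|e c IH|x c IH] s /=.
- by rewrite inE => kk'; rewrite /update (negPf kk').
- by rewrite mem_cat negb_or => /andP[? ?]; rewrite IH2 // IH1.
- by move=> kc; case: ifP => // _; rewrite IH.
rewrite inE negb_or => /andP[kx kc].
set f := fun s1 : store => _; suff H n : iter n f (update s x 0 0) k i = s k i.
  exact: H.
elim: n => [|n IHn] /=; first by rewrite /update (negPf kx).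
by rewrite /f /update (negPf kx) /= IH.
Qed.

Lemma run_input L c s i : well_formed c -> run L c s 0 i = s 0 i.
Proof.
move=> wfc; apply: run_frame; elim: c wfc => //= [k e1 e2|c1 IH1 c2 IH2|x c IH].
- by rewrite inE eq_sym => /andP[].
- by rewrite mem_cat negb_or => /andP[/IH1-> /IH2->].
by rewrite inE negb_or eq_sym => /and3P[-> _ /IH].
Qed.

(** [I n] speaks of the store just before iteration [n], with the counter already set to [n]; the
    body leaves the counter alone, so incrementing it means writing [n.+1]. *)
Lemma run_for L x c (I : nat -> store -> Prop) s :
    x \notin written c -> I 0 (update s x 0 0) ->
    (forall n s1, n < L -> s1 x 0 = n -> I n s1 ->
       I n.+1 (update (run L c s1) x 0 n.+1)) ->
  I L (run L (CFor x c) s).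
Proof.
move=> xc I0 IS /=; set f := fun s1 : store => _.
suff H n : n <= L -> I n (iter n f (update s x 0 0)) /\
    iter n f (update s x 0 0) x 0 = n by case: (H L).
elim: n => [|n IHn] nL; first by rewrite /= {2}/update !eqxx.
have [In xn] := IHn (ltnW nL); rewrite iterS.
move: (iter n f _) In xn => s1 In xn; rewrite /f run_frame // xn addn1.
by split; [apply: IS | rewrite /update !eqxx].
Qed.

(** ** Running time *)

(** Bit length of the value in units of [beta], a bound on the bit length of every stored number;
    bit lengths are subadditive under sum and product alike. *)
Fixpoint esize (e : expr) : nat :=
  match e with
  | Const n => bits n
  | Read _ _ => 1
  | Add e1 e2 | Defs.Sub e1 e2 | Mul e1 e2 => esize e1 + esize e2
  end.

Fixpoint etime (e : expr) : nat :=
  esize e +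
  match e with
  | Const _ => 0
  | Read _ e1 => etime e1
  | Add e1 e2 | Defs.Sub e1 e2 | Mul e1 e2 => etime e1 + etime e2
  end.

Fixpoint egrowth (e : expr) : nat :=
  match e with
  | Const n => n
  | Read _ _ => 1
  | Add e1 e2 | Defs.Sub e1 e2 | Mul e1 e2 => egrowth e1 + egrowth e2
  end.

(** Growth of the largest stored value in units of [V.+1], where [V] bounds the cells of array 0. It
    adds up along a run, hence stays polynomial in [L] even for nested loops. *)
Fixpoint cgrowth (c : cmd) (L : nat) : nat :=
  match c with
  | CWrite _ _ e => egrowth e
  | CSeq c1 c2 => cgrowth c1 L + cgrowth c2 L
  | CIf _ c1 => cgrowth c1 L
  | CFor _ c1 => L * (cgrowth c1 L + 1)
  end.

(** Time in units of [beta]. The 20 per iteration and the one extra iteration generously cover the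
    initialisation, tests and increments of the counter. *)
Fixpoint ctime (c : cmd) (L : nat) : nat :=
  match c with
  | CWrite _ i e => etime i + etime e + 1
  | CSeq c1 c2 => ctime c1 L + ctime c2 L + 1
  | CIf e c1 => etime e + ctime c1 L + 2
  | CFor _ c1 => (L + 1) * (ctime c1 L + 20)
  end.

Lemma poly_cgrowth c : poly_bounded (cgrowth c).
Proof.
elim: c => /= *; do ?[exact: poly_const | exact: poly_id | exact: polyD
  | apply: polyM | apply: polyD]; assumption.
Qed.

Lemma poly_ctime c : poly_bounded (ctime c).
Proof.
elim: c => /= *; do ?[exact: poly_const | exact: poly_id | exact: polyD
  | apply: polyM | apply: polyD]; assumption.
Qed.

Section RunningTime.

Variables (L V : nat).

Definition bounded (B : nat) (s : store) : Prop :=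
  [/\ forall k i, s k i <= B, forall i, s 0 i <= V & s 0 0 = L].

Lemma bounded_le B B' s : B <= B' -> bounded B s -> bounded B' s.
Proof.
by move=> BB' [sB sV sL]; split=> // k i; apply: leq_trans (sB k i) BB'.
Qed.

Lemma bounded_update B s k i v :
  k != 0 -> v <= B -> bounded B s -> bounded B (update s k i v).
Proof.
move=> k0 vB [sB sV sL].
have s0 j : update s k i v 0 j = s 0 j by rewrite /update eq_sym (negPf k0).
by split=> [k' i'|j|]; rewrite ?s0 // /update; case: ifP.
Qed.

Lemma eval_small B s e :
  bounded B s -> small_expr e -> eval s e <= egrowth e * V.+1.
Proof.
move=> [_ sV _]; elim: e => //= [n _|k e _ /eqP->|e1 IH1 e2 IH2|e1 IH1 e2 _].
- by rewrite leq_pmulr.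
- by rewrite mul1n leqW.
- by case/andP=> /IH1 ? /IH2 ?; rewrite mulnDl leq_add.
move/IH1 => ?; rewrite mulnDl (leq_trans (leq_subr _ _)) //.
by rewrite (leq_trans _ (leq_addr _ _)).
Qed.

Lemma eval_additive B s e :
  bounded B s -> additive_expr e -> eval s e <= B + egrowth e * V.+1.
Proof.
move=> sB; have [sB' _ _] := sB.
elim: e => //= [n _|k e _ _|e1 IH1 e2 _|e1 IH1 e2 _].
- by rewrite (leq_trans _ (leq_addl _ _)) // leq_pmulr.
- exact: leq_trans (leq_addr _ _).
- by case/andP=> /IH1 ? /(eval_small sB) ?; rewrite mulnDl addnA leq_add.
move/IH1 => ?; rewrite mulnDl addnA (leq_trans (leq_subr _ _)) //.
by rewrite (leq_trans _ (leq_addr _ _)).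
Qed.

Lemma bits_eval B beta s e :
  bounded B s -> bits B <= beta -> bits (eval s e) <= esize e * beta.
Proof.
move=> [sB _ _] Bb; have b0 : 0 < beta by apply: leq_trans Bb.
elim: e => //= [n|k e _|e1 IH1 e2 IH2|e1 IH1 e2 IH2|e1 IH1 e2 IH2];
  rewrite ?mulnDl.
- by rewrite leq_pmulr.
- by rewrite mul1n (leq_trans _ Bb) // bits_le.
- by rewrite (leq_trans (bitsD _ _)) // leq_add.
- by rewrite (leq_trans (bits_le (leq_subr _ _))) // (leq_trans IH1) // leq_addr.
by rewrite (leq_trans (bitsM _ _)) // leq_add.
Qed.

Lemma eval_cost_le B beta s e :
  bounded B s -> bits B <= beta -> eval_cost s e <= etime e * beta.
Proof.
move=> sB Bb; elim: e => //= [n|k e IH|e1 IH1 e2 IH2|e1 IH1 e2 IH2|e1 IH1 e2 IH2].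
- by rewrite !addn0; apply: (bits_eval (Const n) sB Bb).
- by rewrite mulnDl leq_add //; apply: (bits_eval (Read k e) sB Bb).
- by rewrite !(mulnDl _ _ beta) leq_add ?leq_add // -mulnDl;
  apply: (bits_eval (Add e1 e2) sB Bb).
- by rewrite !(mulnDl _ _ beta) leq_add ?leq_add // -mulnDl;
  apply: (bits_eval (Defs.Sub e1 e2) sB Bb).
by rewrite !(mulnDl _ _ beta) leq_add ?leq_add // -mulnDl;
  apply: (bits_eval (Mul e1 e2) sB Bb).
Qed.

(** Induction with [B] general: every sub-run starts from the bound reached by the previous one,
    while [beta] is a bit length for the final bound and so serves all intermediate stores. *)
Lemma exec_compile c B beta s :
    well_formed c -> bounded B s -> bits (B + cgrowth c L * V.+1) <= beta ->
  exists t, [/\ exec (compile c) s t (run L c s), t <= ctime c L * beta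
              & bounded (B + cgrowth c L * V.+1) (run L c s)].
Proof.
elim: c B s => [k i e|c1 IH1 c2 IH2|e c IH|x c IH] B s /=.
- case/andP=> k0 ade sB Bb; have Bb' := leq_trans (bits_le (leq_addr _ _)) Bb.
  have b0 : 0 < beta by apply: leq_trans Bb.
  have ti := eval_cost_le i sB Bb'; have te := eval_cost_le e sB Bb'.
  exists (eval_cost s i + eval_cost s e).+1; split; first exact: exec_write.
    by rewrite -addn1 !mulnDl !leq_add // mul1n.
  apply: bounded_update => //; first exact: eval_additive.
  exact: bounded_le (leq_addr _ _) sB.
- case/andP=> wf1 wf2 sB; rewrite mulnDl addnA => Bb.
  have b0 : 0 < beta by apply: leq_trans Bb.
  have [t1 [ex1 le1 bd1]] := IH1 _ _ wf1 sB (leq_trans (bits_le (leq_addr _ _)) Bb).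
  have [t2 [ex2 le2 bd2]] := IH2 _ _ wf2 bd1 Bb.
  exists (t1 + t2).+1; split=> //; first exact: exec_seq ex1 ex2.
  by rewrite -addn1 !mulnDl !leq_add // mul1n.
- move=> wfc sB Bb; have b0 : 0 < beta by apply: leq_trans Bb.
  have te := eval_cost_le e sB (leq_trans (bits_le (leq_addr _ _)) Bb).
  case: eqP => [e0|/eqP e0] /=.
    exists (eval_cost s e + 1).+1; split.
    + by apply: exec_if_false => //; apply: exec_skip.
    + by rewrite !mulnDl; lia.
    by apply: bounded_le sB; apply: leq_addr.
  have [t [ex le bd]] := IH B s wfc sB Bb.
  exists (eval_cost s e + t).+1; split=> //; first exact: exec_if_true.
  by rewrite !mulnDl; lia.
case/and3P=> x0 xc wfc sB Bb.
have b0 : 0 < beta by apply: leq_trans Bb.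
set f := fun s1 : store => _.
have le_beta e B1 s1 : bounded B1 s1 ->
    B1 <= B + L * (cgrowth c L + 1) * V.+1 -> eval_cost s1 e <= etime e * beta.
  by move=> sB1 B1B; apply: eval_cost_le sB1 (leq_trans (bits_le B1B) Bb).
(* Here [n] counts the remaining iterations, so [L - n] of them have contributed to the counter and
   to the bound; the 7 pays for the last, failing test. *)
have loop n s1 : n <= L -> s1 x 0 = L - n ->
    bounded (B + (L - n) * (cgrowth c L + 1) * V.+1) s1 ->
    exists t, [/\ exec (While (Defs.Sub (Var 0) (Var x)) (Seq (compile c)
        (Write x (Const 0) (Add (Var x) (Const 1))))) s1 t (iter n f s1),
      t <= (n * (ctime c L + 20) + 7) * beta
      & bounded (B + L * (cgrowth c L + 1) * V.+1) (iter n f s1)].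
  elim: n s1 => [|n IHn] s1 nL s1x bd1.
    rewrite subn0 in s1x bd1.
    exists (eval_cost s1 (Defs.Sub (Var 0) (Var x))).+1; split=> //.
      by apply: exec_while_false => /=; case: bd1 => _ _ ->; rewrite s1x subnn.
    have : eval_cost s1 (Defs.Sub (Var 0) (Var x)) <= 6 * beta.
      exact: (le_beta (Defs.Sub (Var 0) (Var x)) _ _ bd1 (leqnn _)).
    lia.
  have b1 : B + (L - n.+1) * (cgrowth c L + 1) * V.+1 + cgrowth c L * V.+1
      <= B + (L - n) * (cgrowth c L + 1) * V.+1.
    have -> : L - n = (L - n.+1).+1 by lia.
    rewrite mulSn; nia.
  have b2 : B + (L - n) * (cgrowth c L + 1) * V.+1
      <= B + L * (cgrowth c L + 1) * V.+1.
    by rewrite leq_add2l !leq_mul // leq_subr.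
  have [|tc [exc lec bdc]] := IH _ _ wfc bd1.
    by apply: leq_trans Bb; apply: bits_le; apply: leq_trans b2.
  set s2 := run L c s1 in exc bdc.
  have s2x : s2 x 0 = L - n.+1 by rewrite /s2 run_frame.
  have bd2 := bounded_le b1 bdc.
  have [|||tw [exw lew bdw]] := IHn (f s1).
  - exact: ltnW.
  - rewrite /f -/s2 /update !eqxx /= s2x; lia.
  (* The new counter value is the number of completed iterations, each of which adds at least 1 to
     the bound. *)
  - rewrite /f -/s2; apply: bounded_update => //; rewrite s2x.
    have -> : L - n.+1 + 1 = L - n by lia.
    apply: leq_trans (leq_addl _ _).
    by rewrite -mulnA leq_pmulr // muln_gt0 addn1.
  rewrite iterSr.
  exists (eval_cost s1 (Defs.Sub (Var 0) (Var x)) + (tc + (eval_cost s2 (Const 0) +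
    eval_cost s2 (Add (Var x) (Const 1))).+1).+1 + tw).+1; split=> //.
    apply: exec_while_true exw; last by apply: exec_seq exc (exec_write _ _ _ _).
    by rewrite /=; case: bd1 => _ _ ->; rewrite s1x; lia.
  have h1 : _ <= 6 * beta := le_beta (Defs.Sub (Var 0) (Var x)) _ _ bd1
    (leq_trans (leq_addr _ _) (leq_trans b1 b2)).
  have h2 : _ <= 1 * beta := le_beta (Const 0) _ _ bd2 b2.
  have h3 : _ <= 5 * beta := le_beta (Add (Var x) (Const 1)) _ _ bd2 b2.
  move: h1 h2 h3 lec lew b0; rewrite (mulSn n (_ + _)); move: (n * _) => m.
  by rewrite !mulnDl; lia.
have [||t [ext tle bdt]] := loop L (update s x 0 0) (leqnn L).
- by rewrite subnn /update !eqxx.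
- by rewrite subnn mul0n mul0n addn0; apply: bounded_update.
exists ((eval_cost s (Const 0) + eval_cost s (Const 0)).+1 + t).+1; split=> //.
  by apply: exec_seq ext; apply: (exec_write s x (Const 0) (Const 0)).
have : eval_cost s (Const 0) <= 1 * beta.
  by apply: (le_beta (Const 0) _ _ sB); apply: leq_addr.
move: tle b0; rewrite mulnDl mul1n !mulnDl; lia.
Qed.

End RunningTime.

Lemma compile_polytime c : well_formed c ->
  exists b d, forall w, exists t,
    exec (compile c) (load w) t (run (size w) c (load w)) /\
    t <= b * word_size w ^ d + b.
Proof.
move=> wfc.
have [b1 [d1 tle]] := poly_bounded_expn (poly_ctime c).
have [b2 [d2 gle]] := poly_bounded_expn (poly_cgrowth c).
(* The first factor bounds [ctime], the second the bit length of [(cgrowth c L).+1 * (2 ^ S).+1];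
   the 4 collects 2 from [bits_leS] and 2 from the bound [S + 2] for [(2 ^ S).+1]. *)
pose f n := (b1 * n ^ d1 + b1) * (b2 * n ^ d2 + b2 + n + 4).
have poly_f : poly_bounded f.
  have poly_exp b d : poly_bounded (fun n => b * n ^ d + b).
    apply: polyD (poly_const b); apply: polyM (poly_const b) _.
    exists 1, d => n; rewrite mul1n; case: d => // d; by rewrite leq_exp2r.
  by apply: polyM => //; do !apply: polyD => //; [exact: poly_id | exact: poly_const].
have [b [d fle]] := poly_bounded_expn poly_f.
exists b, d => w; set S := word_size w; set L := size w.
have LS : L <= S := leq_size_word_size w.
have w_lt i : nth 0 w i < 2 ^ S.
  have [wi | wi] := ltnP i (size w); last by rewrite nth_default // expn_gt0.
  rewrite (leq_trans (ltn_bits _)) // leq_exp2l //.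
  by rewrite bits_le_word_size // mem_nth.
have load_le k i : load w k i <= 2 ^ S.
  rewrite /load; case: eqP => // _; case: i => [|i] /=; last exact: ltnW.
  by rewrite (leq_trans LS) // ltnW // ltn_expl.
have bd : bounded L (2 ^ S) (2 ^ S) (load w) by split.
have [t [ext lt _]] := exec_compile wfc bd (leqnn _).
exists t; split=> //; apply: leq_trans lt (leq_trans _ (fle S S (leqnn S))).
rewrite leq_mul ?tle //.
apply: leq_trans (_ : bits ((cgrowth c L).+1 * (2 ^ S).+1) <= _).
  by apply: bits_le; rewrite mulSn leq_add2r.
apply: leq_trans (bitsM _ _) _.
have bS : bits (2 ^ S).+1 <= S + 2.
  by apply: bits_leP; rewrite ?expnD ?addn2 //; have := expn_gt0 2 S; lia.
have := bits_leS (cgrowth c L).+1; have := gle _ _ LS; lia.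
Qed.

(** * The cutoff algorithm *)

Section Cutoffs.

Variable G : instance.
Implicit Types (cut : 'I_(nB G) -> nat) (M : assignment G).
Implicit Types (r : option (assignment G)) (a : 'I_(nA G)) (p : 'I_(nB G)).

Definition admitted cut a p : bool := index a (prefB p) < cut p.

Definition choice cut : assignment G :=
  [ffun a => ohead [seq p <- prefA a | admitted cut a p]].

Definition perfect M : bool := [forall a, M a != None].

Definition load_cost M p : nat := #|assigned M p| * cost p.

Definition improves M r : bool :=
  if r is Some M0 then max_cost M < max_cost M0 else true.

Definition new_best cut r : option (assignment G) :=
  if perfect (choice cut) && improves (choice cut) r then Some (choice cut)
  else r.

Definition new_cut cut r p : nat :=
  if r is Some M then
    if max_cost M <= load_cost (choice cut) p then cut p - 1 else cut p
  else cut p.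

Definition round (st : ('I_(nB G) -> nat) * option (assignment G)) :=
  let r := new_best st.1 st.2 in (new_cut st.1 r, r).

(** Since everything improves on [None], for [r = None] this means that nothing is feasible. *)
Definition optimal_answer r : Prop := forall M, feasible M -> ~~ improves M r.

Definition cut_valid cut r : Prop :=
  forall M, feasible M -> improves M r ->
  forall a p, M a = Some p -> admitted cut a p.

Definition best_feasible r : Prop := forall M, r = Some M -> feasible M.

Lemma index_lt_prefB a p : (index a (prefB p) < size (prefB p)) = edge a p.
Proof. by rewrite index_mem mem_prefB. Qed.

Lemma ohead_filter_index (T : eqType) (P : pred T) (l : seq T) x y :
  ohead (filter P l) = Some x -> y \in l -> P y -> index x l <= index y l.
Proof.
elim: l => //= z l IH; case: ifP => [_ [->]|Pz xl]; first by rewrite eqxx.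
rewrite inE; case: eqVneq => [->|zy /= yl Py]; first by rewrite Pz.
by case: (z == x); rewrite // ltnS IH.
Qed.

Lemma choiceP cut a p :
  choice cut a = Some p -> (p \in prefA a) && admitted cut a p.
Proof.
rewrite ffunE => cp; suff : p \in [seq p <- prefA a | admitted cut a p].
  by rewrite mem_filter andbC.
by case: filter cp => //= q l [->]; rewrite mem_head.
Qed.

Lemma choice_best cut a p q : choice cut a = Some p ->
  q \in prefA a -> admitted cut a q -> index p (prefA a) <= index q (prefA a).
Proof. by rewrite ffunE; apply: ohead_filter_index. Qed.

Lemma choice_None cut a p :
  choice cut a = None -> p \in prefA a -> ~~ admitted cut a p.
Proof.
rewrite ffunE => cN pa; apply/negP => ap.
have : p \in [seq p <- prefA a | admitted cut a p] by rewrite mem_filter ap.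
by case: filter cN.
Qed.

Lemma choice_feasible cut :
  perfect (choice cut) -> feasible (choice cut).
Proof.
move=> /forallP pf; split=> [a p /choiceP/andP[]|a p|//].
  by rewrite mem_prefA.
apply/negP; rewrite /blocks; case/and4P=> e neq.
case ca: (choice cut a) (pf a) => [q|//] _ /and3P[_ _ pq].
case/existsP=> a' /andP[]; rewrite inE => /eqP /choiceP/andP[_ ad'].
case/and3P=> _ _ lt.
have := choice_best ca _ (ltn_trans lt ad').
by rewrite mem_prefA e => /(_ isT); rewrite leqNgt pq.
Qed.

(** If a better assignment gave [p] its agent of rank [cut p - 1], then by
    stability it would give [p] all of the agents that now choose [p]. *)
Lemma new_cut_valid cut r :
  cut_valid cut r -> cut_valid (new_cut cut r) r.
Proof.
move=> cv M fM iM a p Map; have ad := cv M fM iM a p Map.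
rewrite /new_cut /admitted; case: r cv iM => [M0|//] cv iM; case: ifP => // le.
rewrite ltnNge; apply/negP => ge.
have rk : index a (prefB p) = cut p - 1 by move: ad ge; rewrite /admitted; lia.
suff sub : assigned (choice cut) p \subset assigned M p.
  have : load_cost (choice cut) p <= max_cost M.
    apply: leq_trans (_ : load_cost M p <= _).
      by rewrite leq_mul // subset_leq_card.
    by rewrite /max_cost (leq_bigmax p).
  by rewrite leqNgt (leq_trans iM le).
have [mM sM pM] := fM.
apply/subsetP => b; rewrite !inE => /eqP cb; apply: contraT => Mb.
have /andP[pb adb] := choiceP cb.
case Mbq : (M b) (pM b) => [q|//] _.
have qb : q \in prefA b by rewrite mem_prefA mM.
have neb : b != a by apply: contraNneq Mb => ->; rewrite Map.
have edgeb : edge b p by rewrite -mem_prefA.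
have edgea : edge a p by apply: mM.
case/negP: (sM b p); rewrite /blocks edgeb Mb /= Mbq /=; apply/andP; split.
  have le_pq := choice_best cb qb (cv M fM iM b q Mbq).
  rewrite /prefers pb qb /= ltn_neqAle le_pq andbT.
  by apply: contra Mb => /eqP/index_inj -> //; rewrite Mbq.
apply/existsP; exists a; rewrite inE Map eqxx /= /prefers !mem_prefB edgea edgeb /=.
rewrite ltn_neqAle; apply/andP; split; last first.
  by rewrite rk; move: adb; rewrite /admitted; lia.
by apply: contra neb => /eqP/index_inj ->; rewrite ?mem_prefB.
Qed.

(** An agent without a choice has no admitting neighbour, whereas an improving feasible assignment
    would give it one. *)
Lemma cut_valid_imperfect cut r :
  cut_valid cut r -> ~~ perfect (choice cut) -> optimal_answer r.
Proof.
move=> cv /forallPn [a]; rewrite negbK => /eqP ca M fM; apply/negP => iM.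
have [mM _ pM] := fM; case Ma : (M a) (pM a) => [p|//] _.
have := choice_None ca (_ : p \in prefA a); rewrite mem_prefA mM //.
by rewrite (cv M fM iM) // => /(_ isT).
Qed.

Lemma improves_new_best cut r M : improves M (new_best cut r) -> improves M r.
Proof.
rewrite /new_best; case: ifP => // /andP[_]; case: r => //= M0.
by move=> lt1 lt2; apply: ltn_trans lt1.
Qed.

(** * Progress and termination of the rounds *)

Definition potential cut : nat := \sum_p cut p.

(** The last clause measures progress: until optimality is reached, each round takes at least 1 from
    the potential, which starts at the total length of the programs' lists. *)
Definition round_invariant n (st : ('I_(nB G) -> nat) * option (assignment G)) :=
  [/\ best_feasible st.2, cut_valid st.1 st.2 &
      optimal_answer st.2 \/
      potential st.1 + n <= \sum_(p < nB G) size (prefB p)].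

Lemma round_invariant0 :
  round_invariant 0 (fun p : 'I_(nB G) => size (prefB p), None).
Proof.
split=> //=; last by right; rewrite addn0.
by move=> M [mM _ _] _ a p /mM; rewrite -index_lt_prefB.
Qed.

Lemma new_cut_le cut r p : new_cut cut r p <= cut p.
Proof. by rewrite /new_cut; case: r => // M; case: ifP => // _; lia. Qed.

(** The recorded best costs at most the current choice if that is perfect, so a program attaining
    the maximum of the choice meets the threshold and its cutoff drops. The exceptions, an imperfect
    choice and a best cost of 0, both mean optimality. *)
Lemma new_cut_potential cut r :
    cut_valid cut r ->
  optimal_answer (new_best cut r) \/
  potential (new_cut cut (new_best cut r)) < potential cut.
Proof.
move=> cv; have [pf|npf] := boolP (perfect (choice cut)); last first.
  by left; rewrite /new_best (negPf npf); apply: cut_valid_imperfect npf.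
have [M1 rE M1le] : exists2 M1, new_best cut r = Some M1
    & max_cost M1 <= max_cost (choice cut).
  rewrite /new_best pf /=; case: r {cv} => [M0|] /=; last by exists (choice cut).
  by case: ltnP => h; [exists (choice cut) | exists M0].
have [M10|M1pos] := posnP (max_cost M1).
  by left=> M _; rewrite rE /= M10 ltn0.
right.
have [p pmax] : exists p, load_cost (choice cut) p = max_cost (choice cut).
  rewrite /max_cost in M1le M1pos *.
  have [p0] : exists p0 : 'I_(nB G), true.
    case: (posnP (nB G)) => [n0|n0]; last by exists (Ordinal n0).
    move: M1pos; rewrite big1 ?ltnn // => i _; have := ltn_ord i.
    by rewrite {2}n0.
  move=> _; have [|q _ qE] := @eq_bigmax_cond _ predT (load_cost (choice cut)).
    by apply/card_gt0P; exists p0.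
  by exists q.
have cutp : 0 < cut p.
  have : 0 < load_cost (choice cut) p by rewrite pmax (leq_trans M1pos).
  rewrite muln_gt0 => /andP[/card_gt0P[a]]; rewrite inE => /eqP/choiceP/andP[_].
  by move=> ad _; apply: leq_ltn_trans ad.
rewrite /potential (bigD1 p) //= [X in _ < X](bigD1 p) //= -addSn leq_add //.
  by rewrite /new_cut rE pmax M1le; lia.
by apply: leq_sum => q _; apply: new_cut_le.
Qed.

Lemma round_invariantS n st :
  round_invariant n st -> round_invariant n.+1 (round st).
Proof.
case: st => cut r [/= bf cv alt].
have cv' : cut_valid cut (new_best cut r).
  by move=> M fM /improves_new_best iM; apply: cv.
split=> /=.
- rewrite /new_best; case: ifP => [/andP[pf _] M [<-]|_ M /bf //].
  exact: choice_feasible.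
- exact: new_cut_valid.
case: alt => [opt|le].
  by left=> M fM; apply: contra (opt M fM); apply: improves_new_best.
by case: (new_cut_potential cv) => [|lt]; [left | right; lia].
Qed.

Lemma iter_round n :
  round_invariant n (iter n round (fun p : 'I_(nB G) => size (prefB p), None)).
Proof.
by elim: n => [|n IH]; [apply: round_invariant0 | apply: round_invariantS].
Qed.

Lemma iter_round_solution n : \sum_(p < nB G) size (prefB p) < n ->
  minmax_solution (iter n round (fun p : 'I_(nB G) => size (prefB p), None)).2.
Proof.
move=> lt; have [bf _ alt] := iter_round n.
have opt : optimal_answer (iter n round (fun p : 'I_(nB G) => size (prefB p), None)).2.
  by case: alt => // le; lia.
case: (iter _ _ _).2 bf opt => [M|] bf opt /=; last by move=> M /opt.
by split; [apply: bf | move=> M' /opt; rewrite /= -leqNgt].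
Qed.

End Cutoffs.

(** * The machine program *)

Notation "c1 ;; c2" := (CSeq c1 c2) (at level 60, right associativity).
(** Truncated subtraction serves as comparison: a difference is nonzero exactly when it is positive,
    and the sum of both differences is the distance of [e1] and [e2]. *)
Notation lt_expr e1 e2 := (Defs.Sub e2 e1).
Notation eq_expr e1 e2 :=
  (Defs.Sub (Const 1) (Add (Defs.Sub e1 e2) (Defs.Sub e2 e1))).
Notation Set_ x e := (CWrite x (Const 0) e).

(** [posA] and [posB] hold the addresses in array 0 at which the segment of an agent or of a program
    starts; [matchA] holds the chosen program plus one, or 0 for none. *)
Notation outA := 1.
Notation xa := 2.
Notation xj := 3.
Notation xi := 4.
Notation xround := 5.
Notation xp := 6.
Notation xcur := 7.
Notation posA := 8.
Notation posB := 9.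
Notation cutA := 10.
Notation matchA := 11.
Notation countA := 12.
Notation xperfect := 13.
Notation xmaxn := 14.
Notation xmaxc := 15.
Notation xbestn := 16.
Notation xbestc := 17.

(** Letter [i] of the input is in cell [i.+1] of array 0. *)
Notation Input e := (Read 0 e).
Notation agents := (Input (Const 1)).
Notation programs := (Input (Const 2)).
Notation Incr e n := (Add e (Const n)).
Notation entryA := (Read posA (Var xa)).
Notation sizeA := (Input entryA).
Notation itemA := (Input (Add (Incr entryA 1) (Var xj))).
Notation entryB := (Read posB (Var xp)).
Notation costB := (Input entryB).
Notation sizeB := (Input (Incr entryB 1)).
Notation loadB := (Mul (Read countA (Var xp)) costB).
Notation entryItem := (Read posB itemA).
Notation best_cost := (Mul (Var xbestn) (Var xbestc)).

Definition parse_agents : cmd :=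
  CFor xa (CIf (lt_expr (Var xa) agents)
    (CWrite posA (Var xa) (Var xcur) ;;
     Set_ xcur (Add (Incr (Var xcur) 1) (Input (Var xcur))))).

Definition parse_programs : cmd :=
  CFor xp (CIf (lt_expr (Var xp) programs)
    (CWrite posB (Var xp) (Var xcur) ;;
     CWrite cutA (Var xp) sizeB ;;
     Set_ xcur (Add (Incr (Var xcur) 2) (Input (Incr (Var xcur) 1))))).

(** Admission is tested by searching the agent among the first [cut p] entries of the list of [p];
    the offset 2 skips the cost and the length. *)
Definition test_program : cmd :=
  CFor xi (CIf (lt_expr (Var xi) (Read cutA itemA))
    (CIf (eq_expr (Input (Add (Incr entryItem 2) (Var xi))) (Var xa))
      (CWrite matchA (Var xa) (Incr itemA 1)))).

(** The loop cannot be left early, so the test that [matchA] is still 0 makes the first admitting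
    program win. *)
Definition choose_program : cmd :=
  CWrite matchA (Var xa) (Const 0) ;;
  CFor xj (CIf (lt_expr (Var xj) sizeA)
    (CIf (eq_expr (Read matchA (Var xa)) (Const 0)) test_program)).

Definition choose_programs : cmd :=
  CFor xa (CIf (lt_expr (Var xa) agents) choose_program).

Definition count_agents : cmd :=
  CFor xp (CIf (lt_expr (Var xp) programs)
    (CWrite countA (Var xp) (Const 0) ;;
     CFor xa (CIf (lt_expr (Var xa) agents)
       (CIf (eq_expr (Read matchA (Var xa)) (Incr (Var xp) 1))
         (CWrite countA (Var xp) (Incr (Read countA (Var xp)) 1)))))).

Definition test_perfect : cmd :=
  Set_ xperfect (Const 1) ;;
  CFor xa (CIf (lt_expr (Var xa) agents)
    (CIf (eq_expr (Read matchA (Var xa)) (Const 0)) (Set_ xperfect (Const 0)))).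

(** The maximal cost is kept as two factors, since a stored value may exceed
    the earlier ones only by a sum of input letters. *)
Definition find_max : cmd :=
  Set_ xmaxn (Const 0) ;; Set_ xmaxc (Const 0) ;;
  CFor xp (CIf (lt_expr (Var xp) programs)
    (CIf (lt_expr (Mul (Var xmaxn) (Var xmaxc)) loadB)
      (Set_ xmaxn (Read countA (Var xp)) ;; Set_ xmaxc costB))).

(** In the condition the product is a conjunction and the sum a disjunction. Cell 1 of [outA], the
    leading letter of the answer, doubles as the flag that a best assignment has been recorded. *)
Definition save_best : cmd :=
  CIf (Mul (Var xperfect)
        (Add (Defs.Sub (Const 1) (Read outA (Const 1)))
             (lt_expr (Mul (Var xmaxn) (Var xmaxc)) best_cost)))
    (CWrite outA (Const 0) (Incr agents 1) ;;
     CWrite outA (Const 1) (Const 1) ;;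
     Set_ xbestn (Var xmaxn) ;; Set_ xbestc (Var xmaxc) ;;
     CFor xa (CIf (lt_expr (Var xa) agents)
       (CWrite outA (Incr (Var xa) 2) (Read matchA (Var xa))))).

Definition lower_cutoffs : cmd :=
  CFor xp (CIf (lt_expr (Var xp) programs)
    (CIf (Mul (Read outA (Const 1)) (lt_expr best_cost (Incr loadB 1)))
      (CWrite cutA (Var xp) (Defs.Sub (Read cutA (Var xp)) (Const 1))))).

Definition one_round : cmd :=
  choose_programs ;; count_agents ;; test_perfect ;; find_max ;;
  save_best ;; lower_cutoffs.

(** The output starts as the one-letter word 0, encoding [None]. Parsing starts at cell 3, after the
    word length and the two counts. *)
Definition minmax_cmd : cmd :=
  CWrite outA (Const 0) (Const 1) ;; Set_ xcur (Const 3) ;;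
  parse_agents ;; parse_programs ;; CFor xround one_round.

Lemma well_formed_minmax : well_formed minmax_cmd.
Proof. by []. Qed.

Lemma eval_eq_expr s e1 e2 :
  (eval s (eq_expr e1 e2) != 0) = (eval s e1 == eval s e2).
Proof. by rewrite /=; lia. Qed.

Lemma run_seq L c1 c2 s : run L (c1 ;; c2) s = run L c2 (run L c1 s).
Proof. by []. Qed.

Lemma run_if L e c s :
  run L (CIf e c) s = if eval s e != 0 then run L c s else s.
Proof. by []. Qed.

(** Every loop makes [L] iterations, but the guard idles those from [n] on; hence [run_for] is
    applied to the invariant at [minn k n]. *)
Lemma run_for_below L x e c n (I : nat -> store -> Prop) s :
    x \notin written c -> n <= L ->
    (forall k s1 v, I k s1 -> I k (update s1 x 0 v)) ->
    (forall k s1, I k s1 -> eval s1 e = n) ->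
    I 0 s ->
    (forall k s1, k < n -> s1 x 0 = k -> I k s1 -> I k.+1 (run L c s1)) ->
  I n (run L (CFor x (CIf (lt_expr (Var x) e) c)) s).
Proof.
move=> xc nL Iu Ie I0 IS.
have := @run_for L x (CIf (lt_expr (Var x) e) c) (fun k => I (minn k n)) s xc.
rewrite (minn_idPr nL); apply=> [|k s1 kL s1x].
  by rewrite min0n; apply: Iu.
rewrite run_if [eval _ _]/= => Ik; apply: Iu.
have -> := Ie _ _ Ik; rewrite s1x subn_eq0 -ltnNge; case: ltnP => kn.
  have /minn_idPl -> : k.+1 <= n by [].
  by apply: IS => //; move: Ik; have /minn_idPl -> : k <= n by apply: ltnW.
by have -> : minn k.+1 n = minn k n by lia.
Qed.

(** * Correctness of the machine program *)

Section Correctness.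

Variables (G : instance) (L : nat).

Definition row_of (n : nat) (l : seq 'I_n) : seq nat := [seq val x | x <- l].

Record inputs (s : store) : Prop := Inputs {
  input_nA : s 0 1 = nA G;
  input_nB : s 0 2 = nB G;
  input_sizeA : forall a : 'I_(nA G), s 0 (s posA a) = size (prefA a);
  input_itemA : forall (a : 'I_(nA G)) j, j < size (prefA a) ->
    s 0 (s posA a + 1 + j) = nth 0 (row_of (prefA a)) j;
  input_cost : forall p : 'I_(nB G), s 0 (s posB p) = cost p;
  input_sizeB : forall p : 'I_(nB G), s 0 (s posB p + 1) = size (prefB p);
  input_itemB : forall (p : 'I_(nB G)) i, i < size (prefB p) ->
    s 0 (s posB p + 2 + i) = nth 0 (row_of (prefB p)) i
}.

Lemma inputs_ext s s' : (forall k, k \in [:: 0; posA; posB] -> s' k =1 s k) ->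
  inputs s -> inputs s'.
Proof.
move=> ss' [h1 h2 h3 h4 h5 h6 h7].
have h0 : s' 0 =1 s 0 by apply: ss'.
have hA : s' posA =1 s posA by apply: ss'.
have hB : s' posB =1 s posB by apply: ss'.
by split=> *; rewrite ?hA ?hB h0 ?(h3, h5, h6) //; [apply: h4 | apply: h7].
Qed.

Lemma inputs_run c s : ~~ has (mem (written c)) [:: 0; posA; posB] ->
  inputs s -> inputs (run L c s).
Proof.
move=> /hasPn wc; apply: inputs_ext => k /wc kc i; exact: run_frame.
Qed.

Lemma inputs_update k i v s : k \notin [:: 0; posA; posB] ->
  inputs s -> inputs (update s k i v).
Proof.
move=> kn; apply: inputs_ext => k' k'i j; rewrite /update.
by case: eqP kn => // <-; rewrite k'i.
Qed.

Definition has_cut (cut : 'I_(nB G) -> nat) (s : store) : Prop :=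
  forall p : 'I_(nB G), s cutA p = cut p.

Definition code (o : option 'I_(nB G)) : nat :=
  if o is Some p then p.+1 else 0.

Definition has_match (M : assignment G) (s : store) : Prop :=
  forall a : 'I_(nA G), s matchA a = code (M a).

Hypothesis nA_le : nA G <= L.
Hypothesis nB_le : nB G <= L.
Hypothesis sizeA_le : forall a : 'I_(nA G), size (prefA a) <= L.
Hypothesis sizeB_le : forall p : 'I_(nB G), size (prefB p) <= L.

(** Lists without repetition let a comparison of letters, which the machine performs, be read as a
    statement on ranks. *)
Lemma nth_index_row n (l : seq 'I_n) x i : uniq l -> i < size l ->
  (nth 0 (row_of l) i == x) = (index x (row_of l) == i).
Proof.
move=> ul il; apply/eqP/eqP => [<-|xi].
  by rewrite index_uniq ?size_map // map_inj_uniq //; apply: val_inj.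
by rewrite -xi nth_index // -index_mem xi size_map.
Qed.

Lemma index_row n (l : seq 'I_n) (x : 'I_n) :
  index (val x) (row_of l) = index x l.
Proof. by rewrite /row_of index_map //; apply: val_inj. Qed.

Lemma test_program_spec cut s (a : 'I_(nA G)) (p : 'I_(nB G)) j :
    inputs s -> has_cut cut s -> cut p <= size (prefB p) ->
    s xa 0 = a -> s xj 0 = j -> j < size (prefA a) ->
    nth 0 (row_of (prefA a)) j = p -> s matchA a = 0 ->
  let s' := run L test_program s in
  s' matchA a = (if admitted cut a p then p.+1 else 0) /\
  forall i : nat, i != val a -> s' matchA i = s matchA i.
Proof.
move=> ins sc cp sa sj jl pj m0 s'.
(* After [k] entries [p] is recorded exactly if it ranks [a] below [k]; at [k = cut p] this is
   admission. *)
pose I k s1 := [/\ inputs s1, has_cut cut s1, s1 xa 0 = a, s1 xj 0 = j &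
  s1 matchA a = (if index a (prefB p) < k then p.+1 else 0) /\
  forall i : nat, i != val a -> s1 matchA i = s matchA i].
have itemE s1 : inputs s1 -> s1 xa 0 = a -> s1 xj 0 = j -> eval s1 itemA = p.
  by move=> in1 a1 j1 /=; rewrite a1 j1 (input_itemA in1).
suff : I (cut p) s' by case.
apply: run_for_below => //.
- exact: leq_trans cp (sizeB_le p).
- by move=> k s1 v [in1 c1 a1 j1 m1]; split=> //; apply: inputs_update.
- move=> k s1 [in1 c1 a1 j1 _]; rewrite [LHS]/= -/(eval s1 itemA) itemE //.
move=> k s1 kp s1k [in1 c1 a1 j1 [ma mi]].
rewrite run_if eval_eq_expr.
have -> : eval s1 (Input (Add (Incr entryItem 2) (Var xi))) =
    nth 0 (row_of (prefB p)) k.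
  by rewrite [LHS]/= -/(eval s1 itemA) itemE // s1k (input_itemB in1) // (leq_trans kp).
rewrite [eval s1 (Var xa)]/= a1 nth_index_row ?prefB_uniq ?(leq_trans kp) //.
rewrite index_row; case: eqP => ik.
  rewrite [run _ _ _]/= -/(eval s1 itemA) itemE // a1.
  split=> //; first exact: inputs_update.
  rewrite /update /= eqxx ik ltnSn addn1; split=> // i ia.
  by rewrite (negPf ia) mi.
split=> //; split=> //; rewrite ma ltnS [in RHS]leq_eqVlt.
by case: eqP ik => // ->.
Qed.

Lemma choose_program_spec cut s (a : 'I_(nA G)) :
    inputs s -> has_cut cut s -> (forall p, cut p <= size (prefB p)) ->
    s xa 0 = a ->
  let s' := run L choose_program s in
  s' matchA a = code (choice cut a) /\
  forall i : nat, i != val a -> s' matchA i = s matchA i.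
Proof.
move=> ins sc cb sa s'; rewrite ffunE.
pose I k s1 := [/\ inputs s1, has_cut cut s1, s1 xa 0 = a &
  s1 matchA a = code (ohead [seq p <- take k (prefA a) | admitted cut a p]) /\
  forall i : nat, i != val a -> s1 matchA i = s matchA i].
suff : I (size (prefA a)) s' by rewrite /I take_size => -[].
rewrite /s' /choose_program run_seq; apply: run_for_below => //.
- by move=> k s1 v [in1 c1 a1 m1]; split=> //; apply: inputs_update.
- by move=> k s1 [in1 c1 a1 _]; rewrite /= a1 (input_sizeA in1).
- rewrite [run _ _ _]/= sa; split=> //; first exact: inputs_update.
  rewrite /update /= eqxx take0; split=> // i ia.
  by rewrite (negPf ia).
move=> k s1 kp s1k [in1 c1 a1 [ma mi]].
rewrite run_if eval_eq_expr [eval s1 _]/= a1 [eval s1 _]/= ma.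
have [p0 _] : exists p0 : 'I_(nB G), true.
  by case: (prefA a) kp => // p0; exists p0.
set p := nth p0 (prefA a) k.
have takeS : [seq q <- take k.+1 (prefA a) | admitted cut a q] =
    [seq q <- take k (prefA a) | admitted cut a q] ++
    [seq q <- [:: p] | admitted cut a q].
  by rewrite (take_nth p0 kp) -cats1 filter_cat.
(* If an earlier program admits [a], its nonzero code disables the test and the head of the filtered
   list is unchanged. *)
rewrite /I takeS; case: (filter _ (take _ _)) ma => [|q l] ma; last by split.
have [] := @test_program_spec cut s1 a p k in1 c1 (cb p) a1 s1k kp _ ma.
  by rewrite (nth_map p0).
move=> ma' mi'; case: (0 =P 0) => // _; split=> //.
- exact: inputs_run.
- by move=> q; rewrite run_frame.
- by rewrite run_frame.
split; first by rewrite ma' /=; case: ifP.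
by move=> i ia; rewrite mi' // mi.
Qed.

Lemma choose_programs_spec cut s :
    inputs s -> has_cut cut s -> (forall p, cut p <= size (prefB p)) ->
  has_match (choice cut) (run L choose_programs s).
Proof.
move=> ins sc cb.
pose I k s1 := [/\ inputs s1, has_cut cut s1 &
  forall a : 'I_(nA G), a < k -> s1 matchA a = code (choice cut a)].
suff [_ _ H] : I (nA G) (run L choose_programs s) by move=> a; apply: H.
apply: run_for_below => //.
- by move=> k s1 v [in1 c1 m1]; split=> //; apply: inputs_update.
- by move=> k s1 [in1 _ _]; apply: input_nA.
move=> k s1 kn s1k [in1 c1 m1].
have [|ma mi] := @choose_program_spec cut s1 (Ordinal kn) in1 c1 cb _; first by [].
split; [exact: inputs_run | by move=> q; rewrite run_frame|].
move=> a; rewrite ltnS leq_eqVlt => /orP[/eqP ak|ak].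
  by have -> : a = Ordinal kn by apply: val_inj.
by rewrite mi ?m1 // neq_ltn ak.
Qed.

Definition has_count (n : 'I_(nB G) -> nat) (s : store) : Prop :=
  forall p : 'I_(nB G), s countA p = n p.

Lemma code_eq (o : option 'I_(nB G)) (p : 'I_(nB G)) :
  (code o == p + 1) = (o == Some p).
Proof.
case: o => [q|] /=; last by rewrite addn1.
by rewrite addn1 eqSS; apply/eqP/eqP => [/val_inj->|[->]].
Qed.

Lemma card_assigned (M : assignment G) p :
  #|assigned M p| = \sum_(a < nA G) (M a == Some p).
Proof.
rewrite -sum1_card big_mkcond; apply: eq_bigr => a _.
by rewrite inE; case: (M a == Some p).
Qed.

Lemma count_agents_spec M s :
    inputs s -> has_match M s ->
  has_count (fun p => #|assigned M p|) (run L count_agents s).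
Proof.
move=> ins sm.
pose I k s1 := [/\ inputs s1, has_match M s1 &
  forall p : 'I_(nB G), p < k -> s1 countA p = #|assigned M p|].
suff [_ _ H] : I (nB G) (run L count_agents s) by move=> p; apply: H.
apply: run_for_below => //.
- by move=> k s1 v [in1 c1 m1]; split=> //; apply: inputs_update.
- by move=> k s1 [in1 _ _]; apply: input_nB.
move=> k s1 kn s1k [in1 m1 c1]; set p := Ordinal kn.
set s2 := run L _ s1.
pose J j s3 := [/\ inputs s3, has_match M s3, s3 xp 0 = k &
  s3 countA k = \sum_(a < nA G | a < j) (M a == Some p) /\
  forall i, i != k -> s3 countA i = s1 countA i].
suff [in2 m2 _ [ck ci]] : J (nA G) s2.
  split=> // q; rewrite ltnS leq_eqVlt => /orP[/eqP qk|qk].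
    have -> : q = p by apply: val_inj.
    rewrite ck card_assigned; apply: eq_bigl => a; by rewrite ltn_ord.
  by rewrite ci ?c1 // neq_ltn qk.
rewrite /s2 run_seq; apply: run_for_below => //.
- by move=> j s3 v [in3 c3 m3]; split=> //; apply: inputs_update.
- by move=> j s3 [in3 _ _ _]; apply: input_nA.
- rewrite [run _ _ _]/= s1k; split=> //; first exact: inputs_update.
  rewrite /update /= eqxx big_pred0 //; split=> // i ik; by rewrite (negPf ik).
move=> j s3 jn s3j [in3 m3 s3k [ck ci]].
rewrite run_if eval_eq_expr [eval s3 _]/= s3j [eval s3 _]/= s3k.
rewrite (m3 (Ordinal jn)) (code_eq _ p).
have sumS : \sum_(a < nA G | a < j.+1) (M a == Some p) =
    (M (Ordinal jn) == Some p) + s3 countA k.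
  rewrite ck (bigD1 (Ordinal jn)) //=; congr (_ + _); apply: eq_bigl => a.
  by rewrite ltnS -val_eqE /= ltn_neqAle andbC.
rewrite /J sumS; case: eqP => _; last by split.
rewrite [run _ _ _]/= s3k; split=> //; first exact: inputs_update.
rewrite /update /= eqxx addnC; split=> // i ik; by rewrite (negPf ik) ci.
Qed.

Lemma test_perfect_spec M s :
    inputs s -> has_match M s -> run L test_perfect s xperfect 0 = perfect M.
Proof.
move=> ins sm.
pose I k s1 := [/\ inputs s1, has_match M s1 &
  s1 xperfect 0 = [forall a : 'I_(nA G), (a < k) ==> (M a != None)]].
suff [_ _ ->] : I (nA G) (run L test_perfect s).
  congr nat_of_bool; apply: eq_forallb => a; by rewrite ltn_ord.
rewrite /test_perfect run_seq; apply: run_for_below => //.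
- by move=> k s1 v [in1 c1 m1]; split=> //; apply: inputs_update.
- by move=> k s1 [in1 _ _]; apply: input_nA.
- split=> //; first exact: inputs_update.
  by rewrite /=; case: forallP => // -[].
move=> k s1 kn s1k [in1 m1 p1].
rewrite run_if eval_eq_expr [eval s1 _]/= s1k (m1 (Ordinal kn)) [eval s1 _]/=.
have -> : (code (M (Ordinal kn)) == 0) = (M (Ordinal kn) == None).
  by case: (M _).
case: eqP => Mk.
  split=> //; first exact: inputs_update.
  rewrite /=; case: forallP => // /(_ (Ordinal kn)); by rewrite Mk ltnSn.
split=> //; rewrite p1; congr nat_of_bool.
apply/forallP/forallP => H a; apply/implyP; last first.
  by move=> ak; apply: (implyP (H a)); apply: ltnW.
rewrite ltnS leq_eqVlt => /orP[/eqP ak|]; last exact/implyP.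
by have -> : a = Ordinal kn; [apply: val_inj | apply/eqP].
Qed.

Lemma find_max_spec M s :
    inputs s -> has_count (fun p => #|assigned M p|) s ->
  let s' := run L find_max s in s' xmaxn 0 * s' xmaxc 0 = max_cost M.
Proof.
move=> ins sm s'.
pose I k s1 := [/\ inputs s1, has_count (fun p => #|assigned M p|) s1 &
  s1 xmaxn 0 * s1 xmaxc 0 = \max_(p < nB G | p < k) load_cost M p].
suff [_ _ ->] : I (nB G) s' by apply: eq_bigl => p; rewrite ltn_ord.
rewrite /s' /find_max !run_seq; apply: run_for_below => //.
- by move=> k s1 v [in1 c1 m1]; split=> //; apply: inputs_update.
- by move=> k s1 [in1 _ _]; apply: input_nB.
- split=> //; first by do 2!apply: inputs_update => //.
  by rewrite big_pred0.
move=> k s1 kn s1k [in1 c1 max1]; set p := Ordinal kn.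
have maxS : \max_(q < nB G | q < k.+1) load_cost M q =
    maxn (load_cost M p) (s1 xmaxn 0 * s1 xmaxc 0).
  rewrite max1 (bigD1 p) //=; congr maxn; apply: eq_bigl => q.
  by rewrite ltnS -val_eqE /= ltn_neqAle andbC.
have loadE : eval s1 loadB = load_cost M p.
  by rewrite /= s1k (c1 p) (input_cost in1 p).
rewrite /I maxS run_if [eval _ _]/= -/(eval s1 loadB) loadE subn_eq0 -ltnNge.
case: ltnP => lt.
  by split=> //; do 2!apply: inputs_update => //.
by split.
Qed.

Definition has_best (r : option (assignment G)) (s : store) : Prop :=
  if r is Some M then
    [/\ s outA 0 = nA G + 1, s outA 1 = 1,
      forall a : 'I_(nA G), s outA (a + 2) = code (M a)
      & s xbestn 0 * s xbestc 0 = max_cost M]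
  else s outA 0 = 1 /\ s outA 1 = 0.

Lemma save_best_spec cut r s :
    inputs s -> has_best r s -> has_match (choice cut) s ->
    s xperfect 0 = perfect (choice cut) ->
    s xmaxn 0 * s xmaxc 0 = max_cost (choice cut) ->
  has_best (new_best cut r) (run L save_best s).
Proof.
move=> ins sr sm sp smax.
(* Matching on [save_best] extracts the body of its conditional without restating it. *)
have -> : run L save_best s = if perfect (choice cut) && improves (choice cut) r
    then run L (if save_best is CIf _ c then c else save_best) s else s.
  rewrite run_if [eval _ _]/= sp smax; congr (if _ then _ else _).
  rewrite muln_eq0 negb_or; case: (perfect _) => //=.
  case: r sr => [M [_ -> _ ->]|[_ ->]] /=; last by [].
  by rewrite subnn add0n subn_eq0 ltnNge.
rewrite /new_best; case: ifP => // _.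
set M := choice cut in sm smax *.
(* Agent [a] is written to cell [a + 2], so the length and the flag in cells 0 and 1 survive the
   copying. *)
pose I k s1 := [/\ inputs s1, has_match M s1,
  s1 xbestn 0 * s1 xbestc 0 = max_cost M, s1 outA 0 = nA G + 1 & 
  s1 outA 1 = 1 /\
  forall a : 'I_(nA G), a < k -> s1 outA (a + 2) = code (M a)].
suff [_ _ ? ? [? H]] : I (nA G)
    (run L (if save_best is CIf _ c then c else save_best) s).
  by split=> // a; apply: H.
rewrite /save_best !run_seq; apply: run_for_below => //.
- by move=> k s1 v [in1 c1 m1]; split=> //; apply: inputs_update.
- by move=> k s1 [in1 _ _ _ _]; apply: input_nA.
- split=> //; first by do 4!apply: inputs_update => //.
  by rewrite /= /update /= (input_nA ins).
move=> k s1 kn s1k [in1 m1 mx o0 [o1 oa]].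
rewrite [run _ _ _]/= s1k (m1 (Ordinal kn)).
split=> //; first exact: inputs_update.
- by rewrite /update /= addn2.
split; first by rewrite /update /= addn2.
move=> a; rewrite ltnS leq_eqVlt => /orP[/eqP ak|ak].
  have -> : a = Ordinal kn by apply: val_inj.
  by rewrite /update /= eqxx.
by rewrite /update /= eqn_add2r ltn_eqF // oa.
Qed.

Lemma lower_cutoffs_spec cut r s :
    inputs s -> has_best r s -> has_cut cut s ->
    has_count (fun p => #|assigned (choice cut) p|) s ->
  has_cut (new_cut cut r) (run L lower_cutoffs s).
Proof.
move=> ins sr sc sn.
(* Lowering in place is harmless: the loads were counted beforehand, and the new cutoff of a program
   uses no other program's cutoff. *)
pose I k s1 := [/\ inputs s1, has_best r s1,
  has_count (fun p => #|assigned (choice cut) p|) s1 &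
  forall p : 'I_(nB G), s1 cutA p = if p < k then new_cut cut r p else cut p].
suff [_ _ _ H] : I (nB G) (run L lower_cutoffs s) by move=> p; rewrite H ltn_ord.
apply: run_for_below => //.
- by move=> k s1 v [in1 c1 m1]; split=> //; apply: inputs_update.
- by move=> k s1 [in1 _ _ _]; apply: input_nB.
move=> k s1 kn s1k [in1 r1 c1 m1]; set p := Ordinal kn.
have loadE : eval s1 loadB = load_cost (choice cut) p.
  by rewrite /= s1k (c1 p) (input_cost in1 p).
have newE q : q != p -> (q < k.+1) = (q < k).
  by move=> qp; rewrite ltnS leq_eqVlt (negPf (qp : val q != k)).
rewrite run_if.
have -> : (eval s1 (Mul (Read outA (Const 1)) (lt_expr best_cost (Incr loadB 1)))
    != 0) = (if r is Some M then max_cost M <= load_cost (choice cut) p else false).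
  rewrite [eval _ _]/= -/(eval s1 loadB) loadE.
  move: r1; case: (r) => [M [_ -> _ ->]|[_ ->]] //=.
  by rewrite mul1n subn_eq0 -ltnNge addn1 ltnS.
have cutp : new_cut cut r p = if (if r is Some M then
   max_cost M <= load_cost (choice cut) p else false) then cut p - 1 else cut p.
  by rewrite /new_cut; case: (r).
case: ifP cutp => _ cutp.
  rewrite [run _ _ _]/= s1k; split=> //; first exact: inputs_update.
  move=> q; rewrite /update /=; have [->|qp] := eqVneq q p.
    by rewrite eqxx ltnSn cutp (m1 p) ltnn.
  by rewrite (negPf (qp : val q != k)) newE // m1.
split=> // q; have [->|qp] := eqVneq q p; last by rewrite newE.
by rewrite ltnSn cutp m1 ltnn.
Qed.

(** Only what survives from round to round is kept; choices, loads and the current maximum are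
    recomputed in each round. *)
Definition represents (st : ('I_(nB G) -> nat) * option (assignment G))
    (s : store) : Prop :=
  [/\ inputs s, has_cut st.1 s & has_best st.2 s].

Lemma has_best_ext r s s' :
  (forall k, k \in [:: outA; xbestn; xbestc] -> s' k =1 s k) ->
  has_best r s -> has_best r s'.
Proof.
move=> ss'; case: r => [M|] /=; last by rewrite !ss'.
by move=> [h0 h1 h2 h3]; rewrite !ss' //; split=> // a; rewrite ss'.
Qed.

Lemma has_best_run c r s :
  ~~ has (mem (written c)) [:: outA; xbestn; xbestc] ->
  has_best r s -> has_best r (run L c s).
Proof. by move=> /hasPn wc; apply: has_best_ext => k /wc kc i; apply: run_frame. Qed.

Lemma has_cut_run c cut s : cutA \notin written c ->
  has_cut cut s -> has_cut cut (run L c s).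
Proof. by move=> wc sc p; rewrite run_frame. Qed.

Lemma has_match_run c M s : matchA \notin written c ->
  has_match M s -> has_match M (run L c s).
Proof. by move=> wc sc p; rewrite run_frame. Qed.

Lemma has_count_run c n s : countA \notin written c ->
  has_count n s -> has_count n (run L c s).
Proof. by move=> wc sc p; rewrite run_frame. Qed.

Lemma one_round_spec st s : (forall p, st.1 p <= size (prefB p)) ->
  represents st s -> represents (round st) (run L one_round s).
Proof.
case: st => cut r cb [ins sc sb]; rewrite /= in cb sc sb.
rewrite -[run L one_round s]/(run L lower_cutoffs (run L save_best
  (run L find_max (run L test_perfect (run L count_agents
  (run L choose_programs s)))))).
have m1 := choose_programs_spec ins sc cb.
have i1 : inputs (run L choose_programs s) by apply: inputs_run.
have c1 : has_cut cut (run L choose_programs s) by apply: has_cut_run.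
have b1 : has_best r (run L choose_programs s) by apply: has_best_run.
(* After each phase the store is generalised, so that only its properties are carried into the
   next. *)
move: (run L choose_programs s) m1 i1 c1 b1 => s1 m1 i1 c1 b1.
have n2 := count_agents_spec i1 m1.
have m2 : has_match (choice cut) (run L count_agents s1) by apply: has_match_run.
have i2 : inputs (run L count_agents s1) by apply: inputs_run.
have c2 : has_cut cut (run L count_agents s1) by apply: has_cut_run.
have b2 : has_best r (run L count_agents s1) by apply: has_best_run.
move: (run L count_agents s1) n2 m2 i2 c2 b2 => s2 n2 m2 i2 c2 b2.
have p3 := test_perfect_spec i2 m2.
have n3 := has_count_run (c := test_perfect) isT n2.
have m3 : has_match (choice cut) (run L test_perfect s2) by apply: has_match_run.
have i3 : inputs (run L test_perfect s2) by apply: inputs_run.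
have c3 : has_cut cut (run L test_perfect s2) by apply: has_cut_run.
have b3 : has_best r (run L test_perfect s2) by apply: has_best_run.
move: (run L test_perfect s2) p3 n3 m3 i3 c3 b3 => s3 p3 n3 m3 i3 c3 b3.
have x4 := find_max_spec i3 n3.
have p4 : run L find_max s3 xperfect 0 = perfect (choice cut) by rewrite run_frame.
have n4 := has_count_run (c := find_max) isT n3.
have m4 : has_match (choice cut) (run L find_max s3) by apply: has_match_run.
have i4 : inputs (run L find_max s3) by apply: inputs_run.
have c4 : has_cut cut (run L find_max s3) by apply: has_cut_run.
have b4 : has_best r (run L find_max s3) by apply: has_best_run.
move: (run L find_max s3) x4 p4 n4 m4 i4 c4 b4 => s4 x4 p4 n4 m4 i4 c4 b4.
have b5 := save_best_spec i4 b4 m4 p4 x4.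
have n5 := has_count_run (c := save_best) isT n4.
have i5 : inputs (run L save_best s4) by apply: inputs_run.
have c5 : has_cut cut (run L save_best s4) by apply: has_cut_run.
split; [exact: inputs_run | exact: lower_cutoffs_spec | exact: has_best_run].
Qed.

Lemma rounds_spec s : represents (fun p => size (prefB p), None) s ->
  represents (iter L (@round G) (fun p => size (prefB p), None))
    (run L (CFor xround one_round) s).
Proof.
move=> s0; pose st n := iter n (@round G) (fun p => size (prefB p), None).
apply: (@run_for _ _ _ (fun n => represents (st n))) => // [|n s1 nL _ [i1 c1 b1]].
  by case: s0 => i0 c0 b0; split=> //; apply: inputs_update.
have [|i2 c2 b2] := @one_round_spec (st n) s1 _ (And3 i1 c1 b1).
  (* Cutoffs never rise, so they stay within the list lengths from which they start. *)
  by elim: (n) => //= m IH p; apply: leq_trans (new_cut_le _ _ _) (IH p).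
by split=> //; apply: inputs_update.
Qed.

Lemma output_best r s : has_best r s -> output s = encode_answer r.
Proof.
case: r => [M [s0 s1 sM _]|[s0 s1]]; last by rewrite /output s0 /mkseq /= s1.
rewrite /output s0 addn1 /encode_answer; set l := map _ _.
rewrite /mkseq /= s1; congr (_ :: _).
have sl : size l = nA G by rewrite size_map size_enum_ord.
apply: (@eq_from_nth _ 0); rewrite ?sl size_map size_iota // => a an.
rewrite (nth_map 0) ?size_iota // nth_iota // (nth_map (Ordinal an)) ?size_enum_ord //.
rewrite (nth_ord_enum (Ordinal an) (Ordinal an)) -[RHS](sM (Ordinal an)).
by rewrite /= addn2 add1n.
Qed.

(** ** Reading the input *)

Definition offset (ss : seq (seq nat)) (k : nat) := size (flatten (take k ss)).

Lemma offsetS ss k : k < size ss ->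
  offset ss k.+1 = offset ss k + size (nth [::] ss k).
Proof.
move=> ks; rewrite /offset (take_nth [::]) // flatten_rcons size_cat.
by [].
Qed.

Lemma nth_flatten_offset ss k j : k < size ss -> j < size (nth [::] ss k) ->
  nth 0 (flatten ss) (offset ss k + j) = nth 0 (nth [::] ss k) j.
Proof.
move=> ks js; rewrite -{1}(cat_take_drop k ss) flatten_cat nth_cat.
by rewrite ltnNge leq_addr /= addKn (drop_nth [::]) //= nth_cat js.
Qed.

Definition segmentsA := [seq encode_list (prefA a) | a <- enum 'I_(nA G)].
Definition segmentsB :=
  [seq cost p :: encode_list (prefB p) | p <- enum 'I_(nB G)].

Lemma size_segmentsA : size segmentsA = nA G.
Proof. by rewrite size_map size_enum_ord. Qed.

Lemma size_segmentsB : size segmentsB = nB G.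
Proof. by rewrite size_map size_enum_ord. Qed.

Lemma nth_segmentsA (a : 'I_(nA G)) :
  nth [::] segmentsA a = size (prefA a) :: row_of (prefA a).
Proof. by rewrite (nth_map a) ?size_enum_ord // nth_ord_enum. Qed.

Lemma nth_segmentsB (p : 'I_(nB G)) :
  nth [::] segmentsB p = [:: cost p, size (prefB p) & row_of (prefB p)].
Proof. by rewrite (nth_map p) ?size_enum_ord // nth_ord_enum. Qed.

Definition startA k := 3 + offset segmentsA k.
Definition startB k := 3 + size (flatten segmentsA) + offset segmentsB k.

Definition loaded (s : store) := s 0 =1 load (encode_instance G) 0.

Lemma load_encode i : load (encode_instance G) 0 (3 + i) =
  nth 0 (flatten segmentsA ++ flatten segmentsB) i.
Proof. by []. Qed.

Lemma load_segmentA s (a : 'I_(nA G)) j : loaded s -> j <= size (prefA a) ->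
  s 0 (startA a + j) = nth 0 (size (prefA a) :: row_of (prefA a)) j.
Proof.
move=> ls ja; rewrite ls /startA -addnA load_encode -nth_segmentsA.
have js : j < size (nth [::] segmentsA a) by rewrite nth_segmentsA /= size_map.
have as_ : a < size segmentsA by rewrite size_segmentsA.
rewrite nth_cat nth_flatten_offset // ifT //.
rewrite -{2}(cat_take_drop a segmentsA) flatten_cat size_cat ltn_add2l.
by rewrite (drop_nth [::]) //= size_cat (leq_trans js) // leq_addr.
Qed.

Lemma load_segmentB s (p : 'I_(nB G)) j : loaded s -> j <= (size (prefB p)).+1 ->
  s 0 (startB p + j) = nth 0 [:: cost p, size (prefB p) & row_of (prefB p)] j.
Proof.
move=> ls jp; rewrite ls /startB -!addnA load_encode -nth_segmentsB.
have js : j < size (nth [::] segmentsB p) by rewrite nth_segmentsB /= size_map.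
have ps : p < size segmentsB by rewrite size_segmentsB.
by rewrite nth_cat ltnNge leq_addr /= addKn nth_flatten_offset.
Qed.

Lemma parse_agents_spec s : loaded s -> s xcur 0 = 3 ->
  let s' := run L parse_agents s in
  s' xcur 0 = startA (nA G) /\ forall a : 'I_(nA G), s' posA a = startA a.
Proof.
move=> ls s3 s'.
pose I k s1 := [/\ loaded s1, s1 xcur 0 = startA k &
  forall a : 'I_(nA G), a < k -> s1 posA a = startA a].
suff [_ ? H] : I (nA G) s' by split=> // a; apply: H.
apply: run_for_below => //.
- by move=> k s1 [l1 _ _]; rewrite [LHS]/= l1.
- by split=> //; rewrite s3 /startA /offset take0.
move=> k s1 kn s1k [l1 c1 p1]; set a := Ordinal kn.
split=> //.
  rewrite [LHS]/= /update /= c1 -[X in s1 0 X]addn0 (load_segmentA (a := a)) //.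
  rewrite /startA offsetS ?size_segmentsA //.
  rewrite (nth_segmentsA a : nth _ _ k = _) /= size_map.
  by rewrite -!addnA add1n.
move=> b; rewrite ltnS leq_eqVlt => /orP[/eqP bk|bk].
  have -> : b = a by apply: val_inj.
  by rewrite /= /update /= s1k eqxx c1.
by rewrite /= /update /= s1k ltn_eqF // p1.
Qed.

Lemma parse_programs_spec s : loaded s -> s xcur 0 = startA (nA G) ->
  let s' := run L parse_programs s in
  has_cut (fun p => size (prefB p)) s' /\
  forall p : 'I_(nB G), s' posB p = startB p.
Proof.
move=> ls s3 s'.
pose I k s1 := [/\ loaded s1, s1 xcur 0 = startB k &
  forall p : 'I_(nB G), p < k ->
    s1 cutA p = size (prefB p) /\ s1 posB p = startB p].
suff [_ _ H] : I (nB G) s' by split=> p; have [] := H p (ltn_ord p).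
apply: run_for_below => //.
- by move=> k s1 [l1 _ _]; rewrite [LHS]/= l1.
(* The programs' segments begin where the agents' end: [startA (nA G)] is [startB 0]. *)
- split=> //; rewrite s3 /startA /startB /offset take0 take_oversize ?addn0 //.
  by rewrite size_segmentsA.
move=> k s1 kn s1k [l1 c1 p1]; set p := Ordinal kn.
have szE : s1 0 (startB k + 1) = size (prefB p) by rewrite (load_segmentB (p := p)).
split=> //.
  rewrite [LHS]/= /update /= c1 szE.
  rewrite /startB offsetS ?size_segmentsB //.
  rewrite (nth_segmentsB p : nth _ _ k = _) /= size_map.
  by rewrite -!addnA add2n.
move=> q; rewrite ltnS leq_eqVlt => /orP[/eqP qk|qk].
  have -> : q = p by apply: val_inj.
  by rewrite /= /update /= s1k !eqxx c1 szE.
by rewrite /= /update /= s1k ltn_eqF //; apply: p1.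
Qed.

Lemma parse_represents :
  represents (fun p => size (prefB p), None)
    (run L (CWrite outA (Const 0) (Const 1) ;; Set_ xcur (Const 3) ;;
      parse_agents ;; parse_programs) (load (encode_instance G))).
Proof.
rewrite !run_seq; set s0 := run L (Set_ _ _) _.
have l0 : loaded s0 by [].
have [c1 a1] := parse_agents_spec l0 erefl.
set s1 := run L parse_agents s0 in c1 a1 *.
have l1 : loaded s1 by move=> i; rewrite /s1 run_input.
have [c2 b2] := parse_programs_spec l1 c1.
set s2 := run L parse_programs s1 in c2 b2 *.
have l2 : loaded s2 by move=> i; rewrite /s2 run_input.
have a2 (a : 'I_(nA G)) : s2 posA a = startA a by rewrite -a1 /s2 run_frame.
split=> //; last first.
  by split; rewrite /s2 run_frame // /s1 run_frame.
split=> [||a|a j ja|p|p|p i ip]; rewrite ?a2 ?b2; try by rewrite l2.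
- by rewrite -[startA a]addn0 load_segmentA.
- by rewrite -addnA load_segmentA // add1n.
- by rewrite -[startB p]addn0 load_segmentB.
- by rewrite load_segmentB.
by rewrite -addnA load_segmentB // add2n.
Qed.

End Correctness.

(** * Length of the encoding and conclusion *)

Lemma size_flatten_enum n (f : 'I_n -> seq nat) :
  size (flatten [seq f a | a <- enum 'I_n]) = \sum_(a < n) size (f a).
Proof. by rewrite size_flatten sumnE big_map big_image; apply: eq_bigl. Qed.

Lemma size_encode_instance G : size (encode_instance G) =
  2 + \sum_(a < nA G) (size (prefA a)).+1 + \sum_(p < nB G) (size (prefB p)).+2.
Proof.
have size2 (x y : nat) l : size [:: x, y & l] = (size l).+2 by [].
rewrite /encode_instance size2 size_cat !size_flatten_enum -addnA add2n.
by congr (_ + _).+2; apply: eq_bigr => i _; rewrite /= size_map.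
Qed.

Theorem theorem1 :
  polytime_solvable encode_instance encode_answer minmax_solution.
Proof.
have [b [d run_time]] := compile_polytime well_formed_minmax.
exists (compile minmax_cmd), b, d => G.
have [t [ext tle]] := run_time (encode_instance G).
set L := size (encode_instance G) in ext.
have sizeL : L = 2 + \sum_(a < nA G) (size (prefA a)).+1
    + \sum_(p < nB G) (size (prefB p)).+2 := size_encode_instance G.
have nA_le : nA G <= L.
  rewrite sizeL -addnA addnCA (leq_trans _ (leq_addr _ _)) //.
  by rewrite -[leqLHS]card_ord -sum1_card leq_sum.
have nB_le : nB G <= L.
  rewrite sizeL (leq_trans _ (leq_addl _ _)) //.
  by rewrite -[leqLHS]card_ord -sum1_card leq_sum.
(* Strictness makes [L] rounds exceed the initial potential, which rules out the alternative to
   optimality in the invariant. *)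
have sum_lt : \sum_(p < nB G) size (prefB p) < L.
  rewrite sizeL -addnA addSn ltnS (leq_trans _ (leq_addl _ _)) //.
  by rewrite (leq_trans _ (leq_addl _ _)) // leq_sum // => p _; lia.
have sizeA_le (a : 'I_(nA G)) : size (prefA a) <= L.
  rewrite sizeL (bigD1 a) //=; lia.
have sizeB_le (p : 'I_(nB G)) : size (prefB p) <= L.
  rewrite sizeL (bigD1 p) //=; lia.
have rep := rounds_spec nA_le nB_le sizeA_le sizeB_le (parse_represents nA_le nB_le).
have [_ _ best] := rep.
exists t, (run L minmax_cmd (load (encode_instance G))).
exists (iter L (@round G) (fun p => size (prefB p), None)).2.
split=> //; first exact: output_best best.
exact: iter_round_solution.
Qed.
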